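(* Let $R=\begin{pmatrix} A & M\\ N & B\end{pmatrix}$ be a Morita context ring such that the trace ideals $MN$ and $NM$ are nilpotent ideals of $A$ and $B$, respectively. Then $R$ is GNC if and only if both $A$ and $B$ are nil-clean.
   Context: Rings are associative with identity $1\neq 0$, not necessarily commutative. An element is nil-clean if it is the sum of an idempotent and a nilpotent element (not required to commute). A ring is nil-clean if all its elements are nil-clean, and GNC (generalized nil-clean) if all its non-units are nil-clean. Morita context ring: $A,B$ are rings, $M$ is an $(A,B)$-bimodule, $N$ is a $(B,A)$-bimodule, and $\phi: M\otimes_B N\to A$ and $\psi: N\otimes_A M\to B$ are bimodule homomorphisms such that, writing $mn:=\phi(m\otimes n)$ and $nm:=\psi(n\otimes m)$, one has $m(nm')=(mn)m'$ and $n(mn')=(nm)n'$ for all $m,m'\in M$, $n,n'\in N$. Then the set $R$ of matrices $\begin{pmatrix} a & m\\ n & b\end{pmatrix}$ with $a\in A$, $m\in M$, $n\in N$, $b\in B$ is a ring under the usual matrix operations. The trace ideals are $MN:=\operatorname{Im}\phi$ (an ideal of $A$) and $NM:=\operatorname{Im}\psi$ (an ideal of $B$). *)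

(* Defs.v *)
From HB Require Import structures.
From mathcomp Require Import all_boot all_algebra.
From mathcomp Require Import ring_quotient generic_quotient.
From mathcomp Require Import boolp.
From mathcomp Require Import freeg.

Set Implicit Arguments.
Unset Strict Implicit.
Unset Printing Implicit Defensive.

Import GRing.Theory.
Local Open Scope ring_scope.
Local Open Scope quotient_scope.

Section NilClean.
Variable R : nzRingType.

Definition idempotent_elt (e : R) : Prop := e * e = e.

Definition nilpotent_elt (x : R) : Prop := exists n : nat, x ^+ n = 0.

(* A bare [nzRingType] carries no unit predicate. *)
Definition is_unit (x : R) : Prop := exists y, x * y = 1 /\ y * x = 1.

Definition nil_clean (x : R) : Prop :=
  exists e q : R, [/\ idempotent_elt e, nilpotent_elt q & x = e + q].

(* The [k]-th power of an ideal: finite sums of products of [k] elements. *)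
Definition ideal_pow (I : R -> Prop) (k : nat) (x : R) : Prop :=
  exists ss : seq (seq R),
    (forall s, s \in ss -> size s = k /\ (forall y, y \in s -> I y)) /\
    x = \sum_(s <- ss) \prod_(y <- s) y.

Definition nilpotent_ideal (I : R -> Prop) : Prop :=
  exists k : nat, forall x, ideal_pow I k x -> x = 0.

End NilClean.

Definition nil_clean_ring (R : nzRingType) : Prop :=
  forall x : R, nil_clean x.

Definition GNC_ring (R : nzRingType) : Prop :=
  forall x : R, ~ is_unit x -> nil_clean x.

HB.mixin Record Lmodule_isBimodule (A B : nzRingType) M
    of GRing.Lmodule A M := {
  rscale : M -> B -> M;
  rscaleA : forall u b c, rscale (rscale u b) c = rscale u (b * c);
  rscale1 : forall u, rscale u 1 = u;
  rscaleDl : forall u v b, rscale (u + v) b = rscale u b + rscale v b;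
  rscaleDr : forall u b c, rscale u (b + c) = rscale u b + rscale u c;
  scale_rscale : forall a u b, a *: rscale u b = rscale (a *: u) b
}.

#[short(type="bimodType")]
HB.structure Definition Bimodule (A B : nzRingType) :=
  { M of GRing.Lmodule A M & Lmodule_isBimodule A B M }.

Notation "u *:> b" := (rscale u b) (at level 40, left associativity).

Section RegularBimodule.
Variable A : nzRingType.
Let rmul (u : A^o) (b : A) : A^o := (u : A) * b.

Fact rmulA u b c : rmul (rmul u b) c = rmul u (b * c).
Proof. by rewrite /rmul mulrA. Qed.
Fact rmul1 u : rmul u 1 = u. Proof. exact: mulr1. Qed.
Fact rmulDl u v b : rmul (u + v) b = rmul u b + rmul v b.
Proof. exact: mulrDl. Qed.
Fact rmulDr u b c : rmul u (b + c) = rmul u b + rmul u c.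
Proof. exact: mulrDr. Qed.
Fact scale_rmul (a : A) u b : a *: rmul u b = rmul (a *: u) b.
Proof. exact: mulrA. Qed.

HB.instance Definition _ := Lmodule_isBimodule.Build A A A^o
  rmulA rmul1 rmulDl rmulDr scale_rmul.
End RegularBimodule.

Section TensorProduct.
Variables (A B C : nzRingType) (M : bimodType A B) (N : bimodType B C).

Notation F := {freeg (M * N)%type / int}.
Notation gen m n := (<< (m, n) >> : F).

(* The subgroup of the free abelian group on M * N generated by the biadditivity
   and B-balancedness relations. *)
Inductive tensor_rel : F -> Prop :=
| tensor_rel0 : tensor_rel 0
| tensor_relB x y : tensor_rel x -> tensor_rel y -> tensor_rel (x - y)
| tensor_relDl m m' n : tensor_rel (gen (m + m') n - (gen m n + gen m' n))
| tensor_relDr m n n' : tensor_rel (gen m (n + n') - (gen m n + gen m n'))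
| tensor_relM m b n : tensor_rel (gen (m *:> b) n - gen m (b *: n)).

Definition tensor_ker : {pred F} := fun x => `[< tensor_rel x >].

Fact tensor_ker_zmod_closed : zmod_closed tensor_ker.
Proof.
split=> [|x y /asboolP Kx /asboolP Ky]; apply/asboolP.
  exact: tensor_rel0.
exact: tensor_relB.
Qed.
HB.instance Definition _ := GRing.isZmodClosed.Build F tensor_ker
  tensor_ker_zmod_closed.

Definition tensor : Type := Quotient.quot tensor_ker.
HB.instance Definition _ := GRing.Zmodule.on tensor.

Local Notation Q := (Quotient.quot tensor_ker).

Definition tens (m : M) (n : N) : tensor := \pi_Q (gen m n).

Fact tensDl m m' n : tens (m + m') n = tens m n + tens m' n.
Proof.
rewrite /tens -[RHS](raddfD (\pi_Q)).
apply/eqP; rewrite -[_ == _]/(_ == _ %[mod Q]) -Quotient.idealrBE.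
exact/asboolP/tensor_relDl.
Qed.

Fact tensDr m n n' : tens m (n + n') = tens m n + tens m n'.
Proof.
rewrite /tens -[RHS](raddfD (\pi_Q)).
apply/eqP; rewrite -[_ == _]/(_ == _ %[mod Q]) -Quotient.idealrBE.
exact/asboolP/tensor_relDr.
Qed.

Fact tensM m b n : tens (m *:> b) n = tens m (b *: n).
Proof.
apply/eqP; rewrite -[_ == _]/(_ == _ %[mod Q]) -Quotient.idealrBE.
exact/asboolP/tensor_relM.
Qed.

Fact tensor_ind (P : tensor -> Prop) :
    P 0 -> (forall t u, P t -> P u -> P (t - u)) ->
    (forall m n, P (tens m n)) ->
  forall t, P t.
Proof.
move=> P0 PB Pt; elim/quotW=> x.
have PN t : P t -> P (- t) by move=> Pt'; rewrite -sub0r; apply: PB.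
have PD t u : P t -> P u -> P (t + u).
  by move=> Pt' Pu; rewrite -[u]opprK; apply: PB => //; apply: PN.
have Pn t n : P t -> P (t *+ n).
  by move=> Pt'; elim: n => [|n IHn]; rewrite ?mulr0n // mulrS; apply: PD.
rewrite -(freeg_sumE x).
rewrite (raddf_sum (\pi_Q)).
apply: (big_ind P) => // -[m n] _.
have -> : << coeff (m, n) x *g (m, n) >> = gen m n *~ coeff (m, n) x.
  by rewrite freegU_mulz intz.
rewrite (raddfMz (\pi_Q)).
case: (coeff _ _) => k; first exact: Pn (Pt m n).
by rewrite NegzE mulrNz; apply: PN; apply: Pn (Pt m n).
Qed.

(* The universal property: [tensor_lift h] is the additive map with
   [tens m n |-> h m n] as soon as [h] is biadditive and balanced. *)
Section Lift.
Variables (V : zmodType) (h : M -> N -> V).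

Definition freeg_lift (x : F) : V :=
  fglift (fun p : M * N => h p.1 p.2 : zmodule V) x.

Definition tensor_lift (t : tensor) : V := freeg_lift (repr (t : Q)).

Hypothesis hDl : forall m m' n, h (m + m') n = h m n + h m' n.
Hypothesis hDr : forall m n n', h m (n + n') = h m n + h m n'.
Hypothesis hM : forall m b n, h (m *:> b) n = h m (b *: n).

Fact freeg_liftB x y : freeg_lift (x - y) = freeg_lift x - freeg_lift y.
Proof. exact: (lift_is_additive (fun p : M * N => h p.1 p.2 : zmodule V)). Qed.

Fact freeg_lift0 : freeg_lift 0 = 0.
Proof. by rewrite -(subrr (0 : F)) freeg_liftB subrr. Qed.

Fact freeg_liftD x y : freeg_lift (x + y) = freeg_lift x + freeg_lift y.
Proof.
by rewrite -[in LHS](opprK y) -[- y]sub0r !freeg_liftB freeg_lift0 sub0r opprK.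
Qed.

Fact freeg_lift_gen m n : freeg_lift (gen m n) = h m n.
Proof.
by rewrite /freeg_lift (liftU (fun p : M * N => h p.1 p.2 : zmodule V)) scale1r.
Qed.

Fact freeg_lift_rel x : tensor_rel x -> freeg_lift x = 0.
Proof.
elim=> [|{}x y _ IHx _ IHy|m m' n|m n n'|m b n].
- exact: freeg_lift0.
- by rewrite freeg_liftB IHx IHy subrr.
- by rewrite freeg_liftB freeg_liftD !freeg_lift_gen hDl subrr.
- by rewrite freeg_liftB freeg_liftD !freeg_lift_gen hDr subrr.
- by rewrite freeg_liftB !freeg_lift_gen hM subrr.
Qed.

Fact tensor_lift_pi x : tensor_lift (\pi_Q x) = freeg_lift x.
Proof.
apply/subr0_eq; rewrite -freeg_liftB; apply: freeg_lift_rel; apply/asboolP.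
by rewrite -[`[< _ >]]/(_ \in tensor_ker) Quotient.idealrBE reprK.
Qed.

Fact tensor_lift_tens m n : tensor_lift (tens m n) = h m n.
Proof. by rewrite tensor_lift_pi freeg_lift_gen. Qed.

Fact tensor_liftB t u : tensor_lift (t - u) = tensor_lift t - tensor_lift u.
Proof.
elim/quotW: t => x; elim/quotW: u => y.
rewrite -[LHS]/(tensor_lift ((\pi_Q x : Q) - \pi_Q y)) -(raddfB (\pi_Q)).
by rewrite !tensor_lift_pi freeg_liftB.
Qed.

Fact tensor_lift0 : tensor_lift 0 = 0.
Proof. by rewrite -(subrr (0 : tensor)) tensor_liftB subrr. Qed.

Fact tensor_liftD t u : tensor_lift (t + u) = tensor_lift t + tensor_lift u.
Proof.
by rewrite -[in LHS](opprK u) -[- u]sub0r !tensor_liftB tensor_lift0 sub0r opprK.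
Qed.
End Lift.

Definition tensor_lscale (a : A) : tensor -> tensor :=
  tensor_lift (fun m n => tens (a *: m) n).

Definition tensor_rscale (t : tensor) (c : C) : tensor :=
  tensor_lift (fun m n => tens m (n *:> c)) t.

Fact tensor_lscaleB a t u :
  tensor_lscale a (t - u) = tensor_lscale a t - tensor_lscale a u.
Proof.
apply: tensor_liftB => *; first by rewrite scalerDr tensDl.
  by rewrite tensDr.
by rewrite scale_rscale tensM.
Qed.

Fact tensor_lscale_tens a m n : tensor_lscale a (tens m n) = tens (a *: m) n.
Proof.
apply: tensor_lift_tens => *; first by rewrite scalerDr tensDl.
  by rewrite tensDr.
by rewrite scale_rscale tensM.
Qed.

Fact tensor_rscaleB t u c :
  tensor_rscale (t - u) c = tensor_rscale t c - tensor_rscale u c.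
Proof.
apply: tensor_liftB => *; first by rewrite tensDl.
  by rewrite rscaleDl tensDr.
by rewrite tensM scale_rscale.
Qed.

Fact tensor_rscale_tens m n c : tensor_rscale (tens m n) c = tens m (n *:> c).
Proof.
apply: tensor_lift_tens => *; first by rewrite tensDl.
  by rewrite rscaleDl tensDr.
by rewrite tensM scale_rscale.
Qed.

Fact tensor_eq (f g : tensor -> tensor) :
    (forall t u, f (t - u) = f t - f u) -> (forall t u, g (t - u) = g t - g u) ->
    (forall m n, f (tens m n) = g (tens m n)) ->
  forall t, f t = g t.
Proof.
move=> fB gB fg; apply: tensor_ind => // [|t u ft fu].
  by rewrite -(subrr (0 : tensor)) fB gB !subrr.
by rewrite fB gB ft fu.
Qed.

Fact tensor_scaleA a b t :
  tensor_lscale a (tensor_lscale b t) = tensor_lscale (a * b) t.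
Proof.
move: t; apply: tensor_eq => [t u|t u|m n]; rewrite ?tensor_lscaleB //.
by rewrite !tensor_lscale_tens scalerA.
Qed.

Fact tensor_scale1 t : tensor_lscale 1 t = t.
Proof.
move: t; apply: tensor_eq => [t u|t u|m n]; rewrite ?tensor_lscaleB //.
by rewrite tensor_lscale_tens scale1r.
Qed.

Fact tensor_scaleDr a : {morph tensor_lscale a : t u / t + u}.
Proof.
move=> t u; apply: tensor_liftD => *; first by rewrite scalerDr tensDl.
  by rewrite tensDr.
by rewrite scale_rscale tensM.
Qed.

Fact tensor_scaleDl t a b :
  tensor_lscale (a + b) t = tensor_lscale a t + tensor_lscale b t.
Proof.
move: t; apply: tensor_eq => [t u|t u|m n].
- by rewrite tensor_lscaleB.
- by rewrite !tensor_lscaleB opprD addrACA.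
- by rewrite !tensor_lscale_tens scalerDl tensDl.
Qed.

HB.instance Definition _ := GRing.Zmodule_isLmodule.Build A tensor
  tensor_scaleA tensor_scale1 tensor_scaleDr (fun t a b => tensor_scaleDl t a b).

Fact tensor_rscaleA t b c :
  tensor_rscale (tensor_rscale t b) c = tensor_rscale t (b * c).
Proof.
move: t; apply: (@tensor_eq (fun t => tensor_rscale (tensor_rscale t b) c)
  (tensor_rscale^~ (b * c))) => [t u|t u|m n]; rewrite ?tensor_rscaleB //.
by rewrite !tensor_rscale_tens rscaleA.
Qed.

Fact tensor_rscale1 t : tensor_rscale t 1 = t.
Proof.
move: t; apply: (@tensor_eq (tensor_rscale^~ 1) id) => [t u|t u|m n] //.
  exact: tensor_rscaleB.
by rewrite tensor_rscale_tens rscale1.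
Qed.

Fact tensor_rscaleDl t u c :
  tensor_rscale (t + u) c = tensor_rscale t c + tensor_rscale u c.
Proof.
apply: tensor_liftD => *; first by rewrite tensDl.
  by rewrite rscaleDl tensDr.
by rewrite tensM scale_rscale.
Qed.

Fact tensor_rscaleDr t b c :
  tensor_rscale t (b + c) = tensor_rscale t b + tensor_rscale t c.
Proof.
move: t; apply: (@tensor_eq (tensor_rscale^~ (b + c))
  (fun t => tensor_rscale t b + tensor_rscale t c)) => [t u|t u|m n].
- exact: tensor_rscaleB.
- by rewrite !tensor_rscaleB opprD addrACA.
- by rewrite !tensor_rscale_tens rscaleDr tensDr.
Qed.

Fact tensor_scale_rscale a t c :
  tensor_lscale a (tensor_rscale t c) = tensor_rscale (tensor_lscale a t) c.
Proof.
move: t; apply: (@tensor_eq (fun t => tensor_lscale a (tensor_rscale t c))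
  (fun t => tensor_rscale (tensor_lscale a t) c)) => [t u|t u|m n].
- by rewrite tensor_rscaleB tensor_lscaleB.
- by rewrite tensor_lscaleB tensor_rscaleB.
- by rewrite tensor_rscale_tens !tensor_lscale_tens tensor_rscale_tens.
Qed.

HB.instance Definition _ := Lmodule_isBimodule.Build A C tensor
  tensor_rscaleA tensor_rscale1 tensor_rscaleDl tensor_rscaleDr
  tensor_scale_rscale.

Fact scale_tens a m n : a *: tens m n = tens (a *: m) n.
Proof. exact: tensor_lscale_tens. Qed.

Fact rscale_tens m n c : tens m n *:> c = tens m (n *:> c).
Proof. exact: tensor_rscale_tens. Qed.

End TensorProduct.

Record bimod_hom (A B : nzRingType) (U V : bimodType A B) := BimodHom {
  bimod_fun :> {linear U -> V};
  bimod_homZr : forall u b, bimod_fun (u *:> b) = bimod_fun u *:> b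
}.

Record morita_context (A B : nzRingType)
    (M : bimodType A B) (N : bimodType B A) := MoritaContext {
  mphi : bimod_hom (tensor M N) A^o;
  mpsi : bimod_hom (tensor N M) B^o;
  morita_MNM : forall (m : M) (n : N) (m' : M),
    m *:> (mpsi (tens n m') : B) = (mphi (tens m n) : A) *: m';
  morita_NMN : forall (n : N) (m : M) (n' : N),
    n *:> (mphi (tens m n') : A) = (mpsi (tens n m) : B) *: n'
}.

Record morita_mx (A B : nzRingType) (M : bimodType A B) (N : bimodType B A) :=
  MoritaMx { m11 : A; m12 : M; m21 : N; m22 : B }.

Section MoritaRing.
Variables (A B : nzRingType) (M : bimodType A B) (N : bimodType B A).
Variable K : morita_context M N.

Definition trace_MN (a : A) : Prop := exists t : tensor M N, a = mphi K t.
Definition trace_NM (b : B) : Prop := exists t : tensor N M, b = mpsi K t.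

(* The phantom argument [K] lets the multiplication be inferred from the type. *)
Definition morita_ring of morita_context M N : Type := morita_mx M N.
Local Notation R := (morita_ring K).

Definition morita_tuple (x : R) := (m11 x, m12 x, m21 x, m22 x).
Definition tuple_morita (x : A * M * N * B) : R :=
  let: (a, m, n, b) := x in MoritaMx a m n b.
Fact morita_tupleK : cancel morita_tuple tuple_morita. Proof. by case. Qed.
HB.instance Definition _ := Choice.copy R (can_type morita_tupleK).

Definition morita_zero : R := MoritaMx 0 0 0 0.
Definition morita_opp (x : R) : R := MoritaMx (- m11 x) (- m12 x) (- m21 x) (- m22 x).
Definition morita_add (x y : R) : R :=
  MoritaMx (m11 x + m11 y) (m12 x + m12 y) (m21 x + m21 y) (m22 x + m22 y).
Definition morita_one : R := MoritaMx 1 0 0 1.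
Definition morita_mul (x y : R) : R := MoritaMx
  (m11 x * m11 y + mphi K (tens (m12 x) (m21 y)))
  (m11 x *: m12 y + m12 x *:> m22 y)
  (m21 x *:> m11 y + m22 x *: m21 y)
  (mpsi K (tens (m21 x) (m12 y)) + m22 x * m22 y).

Fact morita_addA : associative morita_add.
Proof. by move=> x y z; rewrite /morita_add /= !addrA. Qed.
Fact morita_addC : commutative morita_add.
Proof. by move=> x y; congr MoritaMx; apply: addrC. Qed.
Fact morita_add0 : left_id morita_zero morita_add.
Proof. by case=> *; rewrite /morita_add /= !add0r. Qed.
Fact morita_addN : left_inverse morita_zero morita_opp morita_add.
Proof. by case=> *; rewrite /morita_add /= !addNr. Qed.
HB.instance Definition _ := GRing.isZmodule.Build R
  morita_addA morita_addC morita_add0 morita_addN.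

Fact rscale0 (A' B' : nzRingType) (U : bimodType A' B') (u : U) :
  u *:> (0 : B') = 0.
Proof. by apply: (addrI (u *:> 0)); rewrite -rscaleDr !addr0. Qed.
Fact rscale0l (A' B' : nzRingType) (U : bimodType A' B') (b : B') :
  (0 : U) *:> b = 0.
Proof. by apply: (addrI ((0 : U) *:> b)); rewrite -rscaleDl !addr0. Qed.
Fact tens0l (A' B' C' : nzRingType) (U : bimodType A' B') (V : bimodType B' C')
  (v : V) : tens (0 : U) v = 0.
Proof. by apply: (addrI (tens (0 : U) v)); rewrite -tensDl !addr0. Qed.
Fact tens0r (A' B' C' : nzRingType) (U : bimodType A' B') (V : bimodType B' C')
  (u : U) : tens u (0 : V) = 0.
Proof. by apply: (addrI (tens u (0 : V))); rewrite -tensDr !addr0. Qed.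

Fact mphiZl a m n : mphi K (tens (a *: m) n) = a * mphi K (tens m n).
Proof. by rewrite -scale_tens linearZ. Qed.
Fact mphiZr m n a : mphi K (tens m (n *:> a)) = (mphi K (tens m n) : A) * a.
Proof. by rewrite -rscale_tens bimod_homZr. Qed.
Fact mpsiZl b n m : mpsi K (tens (b *: n) m) = b * mpsi K (tens n m).
Proof. by rewrite -scale_tens linearZ. Qed.
Fact mpsiZr n m b : mpsi K (tens n (m *:> b)) = (mpsi K (tens n m) : B) * b.
Proof. by rewrite -rscale_tens bimod_homZr. Qed.

Fact morita_mulA : associative morita_mul.
Proof.
move=> [a m n b] [a' m' n' b'] [a'' m'' n'' b'']; rewrite /morita_mul /=.
congr MoritaMx.
- rewrite !mulrDr !mulrDl tensDl tensDr !linearD /=.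
  by rewrite mphiZl mphiZr -tensM mulrA -!addrA; congr (_ + _); rewrite addrCA.
- rewrite scalerDr scalerDl rscaleDr rscaleDl -scalerA -scale_rscale -rscaleA.
  by rewrite morita_MNM -!addrA; congr (_ + _); rewrite addrCA.
- rewrite scalerDr scalerDl rscaleDr rscaleDl -scalerA -scale_rscale -rscaleA.
  by rewrite morita_NMN -!addrA; congr (_ + _); rewrite addrCA.
- rewrite !mulrDr !mulrDl tensDl tensDr !linearD /=.
  by rewrite mpsiZl mpsiZr -tensM mulrA -!addrA; congr (_ + _); rewrite addrCA.
Qed.

Fact morita_mul1l : left_id morita_one morita_mul.
Proof.
case=> a m n b; rewrite /morita_mul /= !mul1r !scale1r !rscale0l !tens0l.
by rewrite !linear0 !addr0 !add0r.
Qed.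

Fact morita_mul1r : right_id morita_one morita_mul.
Proof.
case=> a m n b; rewrite /morita_mul /= !mulr1 !scaler0 !rscale1 !tens0r.
by rewrite !linear0 !addr0 !add0r.
Qed.

Fact morita_mulDl : left_distributive morita_mul morita_add.
Proof.
move=> [a m n b] [a' m' n' b'] [a'' m'' n'' b''].
rewrite /morita_mul /morita_add /= !mulrDl !scalerDl !rscaleDl !tensDl !linearD.
by congr MoritaMx; rewrite addrACA.
Qed.

Fact morita_mulDr : right_distributive morita_mul morita_add.
Proof.
move=> [a m n b] [a' m' n' b'] [a'' m'' n'' b''].
rewrite /morita_mul /morita_add /= !mulrDr !scalerDr !rscaleDr !tensDr !linearD.
by congr MoritaMx; rewrite addrACA.
Qed.

Fact morita_one_neq0 : morita_one != 0.
Proof. by apply/eqP=> /(congr1 (fun x : R => m11 x)) /eqP; rewrite /= oner_eq0. Qed.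

HB.instance Definition _ := GRing.Zmodule_isNzRing.Build R
  morita_mulA morita_mul1l morita_mul1r morita_mulDl morita_mulDr
  morita_one_neq0.

End MoritaRing.

(* Main.v *)
(* The set I of matrices with diagonal entries in MN and NM is an ideal of R,
   and R / I = A / MN x B / NM. It is nil: a product of two off-diagonal
   matrices is diagonal with entries in the trace ideals, so long products of
   off-diagonal matrices vanish. Filter R by the number of off-diagonal factors
   needed to annihilate an element from the left; an element of MN x NM is a
   sum of products of two off-diagonal matrices, so every element of I lowers
   this filtration.
   If A and B are nil-clean, decompose the diagonal of x and put the
   off-diagonal part of x into the nilpotent summand, which is nilpotent
   modulo I. Conversely diag(a, 0) is never a unit, and the (1,1) entry of a
   nil-clean decomposition of it is one of a modulo the nil ideal MN, along
   which idempotents lift; likewise for diag(0, b). *)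
Require Import Defs.
From mathcomp Require Import all_boot all_algebra.
From mathcomp Require Import ring.

Set Implicit Arguments.
Unset Strict Implicit.
Unset Printing Implicit Defensive.

Import GRing.Theory.
Local Open Scope ring_scope.

(** * Lifting idempotents *)

(* Newton iteration for [x ^+ 2 - x]: the defect [p * p - p] of
   [p + (p * p - p) * (1 - 2 p)] is divisible by the square of the old one. *)
Lemma rmorph_idempotent_lift (S : comNzRingType) (R : nzRingType)
    (ev : {rmorphism S -> R}) (n : nat) (p : S) :
  ev (p * p - p) ^+ (2 ^ n) = 0 ->
  exists c, idempotent_elt (ev (p + (p * p - p) * c)).
Proof.
elim: n p => [|n IHn] p.
  rewrite expr1 rmorphB rmorphM => /subr0_eq ee; exists 0.
  by rewrite mulr0 addr0.
move=> nil_d; pose q := p + (p * p - p) * (1 - 2 * p).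
(* With d = p * p - p, (1 - 2 * p)^2 = 1 + 4 * d, and the cofactor is 4 * d - 3. *)
have qE : q * q - q = (p * p - p) ^+ 2 * (4 * p * p - 4 * p - 3).
  by rewrite /q; ring.
have /IHn[c idem_f] : ev (q * q - q) ^+ (2 ^ n) = 0.
  by rewrite qE -rmorphXn exprMn -exprM -expnS rmorphM /= rmorphXn nil_d mul0r.
exists ((1 - 2 * p) + (p * p - p) * (4 * p * p - 4 * p - 3) * c).
congr (idempotent_elt (ev _)): idem_f.
by rewrite qE /q; ring.
Qed.

(** The iteration needs commutativity: it runs on ['X] in [{poly int}] and reaches [R] by evaluation
    at [e]. *)
Lemma idempotent_lift (R : nzRingType) (e : R) :
  nilpotent_elt (e * e - e) ->
  exists c, idempotent_elt (e + (e * e - e) * c).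
Proof.
case=> n nil_d.
have cfe : commr_rmorph (intmul (1 : R)) e by move=> k; apply: commr_int.
pose ev : {rmorphism {poly int} -> R} := horner_morph cfe.
have evX : ev 'X = e by apply: horner_morphX.
have evd : ev ('X * 'X - 'X) = e * e - e by rewrite rmorphB rmorphM /= evX.
have [|c] := @rmorph_idempotent_lift _ _ ev n 'X.
  (* As n < 2 ^ n, the defect also vanishes at the exponent 2 ^ n. *)
  by rewrite evd -(subnKC (ltnW (ltn_expl n (ltnSn 1)))) exprD nil_d mul0r.
by rewrite rmorphD rmorphM /= evd evX; exists (ev c).
Qed.

(** * Nilpotent and nil ideals *)

Lemma nilpotent_ideal_prod (R : nzRingType) (I : R -> Prop) :
  nilpotent_ideal I ->
  exists k, forall s : seq R, (k <= size s)%N ->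
    (forall y, y \in s -> I y) -> \prod_(y <- s) y = 0.
Proof.
case=> k Ik0; exists k => s le_ks sI.
rewrite -(cat_take_drop k s) big_cat /= [X in X * _]Ik0 ?mul0r //.
exists [:: take k s]; split; last by rewrite big_seq1.
move=> _ /[1!inE] /eqP ->; split; first by rewrite size_take_min (minn_idPl _).
by move=> y /mem_take /sI.
Qed.

Lemma nilpotent_ideal_nil (R : nzRingType) (I : R -> Prop) (x : R) :
  nilpotent_ideal I -> I x -> nilpotent_elt x.
Proof.
case/nilpotent_ideal_prod=> k Ik0 Ix; exists k.
have <- : \prod_(y <- nseq k x) y = x ^+ k by rewrite big_nseq -Monoid.iteropE.
apply: Ik0 => [|y]; first by rewrite size_nseq.
by rewrite mem_nseq => /andP[_ /eqP->].
Qed.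

Definition two_sided_ideal (R : nzRingType) (J : R -> Prop) : Prop :=
  [/\ forall x y, J x -> J y -> J (x + y), forall a x, J x -> J (a * x)
    & forall a x, J x -> J (x * a)].

Lemma two_sided_idealN (R : nzRingType) (J : R -> Prop) (x : R) :
  two_sided_ideal J -> J x -> J (- x).
Proof. by case=> _ JMl _ Jx; rewrite -mulN1r; apply: JMl. Qed.

(** Lifting [e] changes it by an element of [J]; subtracting that from [q] keeps the n-th power in
    [J], hence nilpotent. *)
Lemma nil_clean_modulo_nil (R : nzRingType) (J : R -> Prop) (e q : R) (n : nat) :
  two_sided_ideal J -> (forall x, J x -> nilpotent_elt x) ->
  J (e * e - e) -> J (q ^+ n) -> nil_clean (e + q).
Proof.
case=> JD JMl JMr Jnil Jd Jq.
have [c idem_f] := idempotent_lift (Jnil _ Jd).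
set d := e * e - e in Jd idem_f.
have Jdc : J (- (d * c)) by rewrite -mulrN; apply: JMr.
exists (e + d * c), (q - d * c).
split=> //; last by rewrite addrACA subrr addr0.
have JXn r : J ((q - d * c) ^+ r - q ^+ r).
  elim: r => [|r IHr]; first by rewrite subrr -(mulr0 d); apply: JMr.
  have -> : (q - d * c) ^+ r.+1 - q ^+ r.+1 =
      (q - d * c) * ((q - d * c) ^+ r - q ^+ r) - d * c * q ^+ r.
    by rewrite !exprS mulrBr -[RHS]addrA -opprD -mulrDl subrK.
  by apply: JD; [apply: JMl | rewrite -mulNr; apply: JMr].
have /Jnil[k nil_k] : J ((q - d * c) ^+ n).
  by rewrite -[_ ^+ n](subrK (q ^+ n)); apply: JD.
by exists (n * k)%N; rewrite exprM.
Qed.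

Lemma trace_MN_ideal (A B : nzRingType) (M : bimodType A B) (N : bimodType B A)
    (K : morita_context M N) : two_sided_ideal (trace_MN K).
Proof.
split=> [x y [t ->] [u ->]|a x [t ->]|a x [t ->]].
- by exists (t + u); rewrite raddfD.
- by exists (a *: t); rewrite linearZ.
- by exists (t *:> a); rewrite bimod_homZr.
Qed.

Lemma trace_NM_ideal (A B : nzRingType) (M : bimodType A B) (N : bimodType B A)
    (K : morita_context M N) : two_sided_ideal (trace_NM K).
Proof.
split=> [x y [t ->] [u ->]|a x [t ->]|a x [t ->]].
- by exists (t + u); rewrite raddfD.
- by exists (a *: t); rewrite linearZ.
- by exists (t *:> a); rewrite bimod_homZr.
Qed.

(** * Diagonal and off-diagonal matrices *)

Section MoritaRingTheory.
Variables (A B : nzRingType) (M : bimodType A B) (N : bimodType B A).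
Variable K : morita_context M N.
Local Notation R := (morita_ring K).

Definition morita_diag (a : A) (b : B) : R := MoritaMx a 0 0 b.
Definition morita_off (m : M) (n : N) : R := MoritaMx 0 m n 0.

Lemma morita_diagM a b a' b' :
  morita_diag a b * morita_diag a' b' = morita_diag (a * a') (b * b').
Proof.
rewrite /morita_diag [LHS]/GRing.mul /= /morita_mul /=.
by rewrite !tens0l !scaler0 !rscale0l !raddf0 !addr0 add0r.
Qed.

Lemma morita_diagB a b a' b' :
  morita_diag (a - a') (b - b') = morita_diag a b - morita_diag a' b'.
Proof. by congr MoritaMx; rewrite /= subr0. Qed.

Lemma morita_offM m n m' n' :
  morita_off m n * morita_off m' n' =
  morita_diag (mphi K (tens m n')) (mpsi K (tens n m')).
Proof.
rewrite /morita_off [LHS]/GRing.mul /= /morita_mul /=.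
by rewrite !mul0r add0r addr0 !scale0r !rscale0 !addr0.
Qed.

(** Modulo MN the (1,1) entry is multiplicative. *)
Lemma m11_XnB (x : R) n : trace_MN K (m11 (x ^+ n) - m11 x ^+ n).
Proof.
have [JD JMl JMr] := trace_MN_ideal K.
elim: n => [|n IHn]; first by exists 0; rewrite raddf0 subrr.
have -> : m11 (x ^+ n.+1) - m11 x ^+ n.+1 =
    m11 x * (m11 (x ^+ n) - m11 x ^+ n) + mphi K (tens (m12 x) (m21 (x ^+ n))).
  by rewrite !exprS mulrBr addrAC.
by apply: JD; [apply: JMl | exists (tens (m12 x) (m21 (x ^+ n)))].
Qed.

Lemma m22_XnB (x : R) n : trace_NM K (m22 (x ^+ n) - m22 x ^+ n).
Proof.
have [JD JMl JMr] := trace_NM_ideal K.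
elim: n => [|n IHn]; first by exists 0; rewrite raddf0 subrr.
have -> : m22 (x ^+ n.+1) - m22 x ^+ n.+1 =
    mpsi K (tens (m21 x) (m12 (x ^+ n))) + m22 x * (m22 (x ^+ n) - m22 x ^+ n).
  by rewrite !exprS mulrBr addrA.
by apply: JD; [exists (tens (m21 x) (m12 (x ^+ n))) | apply: JMl].
Qed.

(** * Filtration by products of off-diagonal matrices *)

Fixpoint off_ann (j : nat) (w : R) : Prop :=
  if j is j'.+1 then forall m n, off_ann j' (morita_off m n * w) else w = 0.

Lemma off_annB j w w' : off_ann j w -> off_ann j w' -> off_ann j (w - w').
Proof.
elim: j w w' => /= [_ _ -> ->|j IHj w w' Hw Hw' m n]; first exact: subrr.
by rewrite mulrBr; apply: IHj.
Qed.

Lemma off_annS j w : off_ann j w -> off_ann j.+1 w.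
Proof.
elim: j w => /= [_ -> m n|j IHj w Hw m n]; first exact: mulr0.
exact: IHj.
Qed.

Lemma off_ann0 j : off_ann j 0.
Proof. by elim: j => //= j IHj m n; rewrite mulr0. Qed.

Lemma off_ann_trace j w a b :
  trace_MN K a -> trace_NM K b ->
  off_ann j.+2 w -> off_ann j (morita_diag a b * w).
Proof.
move=> [t ->] [u ->] Hw.
(* [off_annB] handles differences; the sign is then absorbed into [u]. *)
have diagD0 : morita_diag (mphi K t) (mpsi K u) =
    morita_diag (mphi K t) 0 - morita_diag 0 (- mpsi K u).
  by rewrite -morita_diagB subr0 sub0r opprK.
rewrite diagD0 mulrBl -raddfN; apply: off_annB.
  move: t {diagD0}; apply: tensor_ind => [|t1 t2 IH1 IH2|m n].
  - by rewrite raddf0 mul0r; apply: off_ann0.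
  - by rewrite raddfB -[0]subr0 morita_diagB mulrBl; apply: off_annB.
  (* A pure tensor in a corner is a product of two off-diagonal matrices, which costs two levels. *)
  - have -> : morita_diag (mphi K (tens m n)) 0 = morita_off m 0 * morita_off 0 n.
      by rewrite morita_offM tens0l raddf0.
    by rewrite -mulrA; apply: Hw.
move: (- u); apply: tensor_ind => [|t1 t2 IH1 IH2|n m].
- by rewrite raddf0 mul0r; apply: off_ann0.
- by rewrite raddfB -[0]subr0 morita_diagB mulrBl; apply: off_annB.
- have -> : morita_diag 0 (mpsi K (tens n m)) = morita_off 0 n * morita_off m 0.
    by rewrite morita_offM tens0l raddf0.
  by rewrite -mulrA; apply: Hw.
Qed.

(** Pairing 2j off-diagonal factors gives j diagonal ones with entries in the trace ideals. The pair
    next to [w] ends the lists, hence [rcons]. *)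
Lemma off_ann_prods j w :
  (forall (s : seq A) (t : seq B), size s = j -> size t = j ->
     (forall y, y \in s -> trace_MN K y) -> (forall y, y \in t -> trace_NM K y) ->
     morita_diag (\prod_(y <- s) y) (\prod_(y <- t) y) * w = 0) ->
  off_ann j.*2 w.
Proof.
elim: j w => [|j IHj] w Hw /=.
  have := Hw [::] [::] erefl erefl; rewrite !big_nil -[morita_diag 1 1]/(1 : R).
  by rewrite mul1r; apply.
move=> m n m' n'; rewrite mulrA morita_offM.
apply: IHj => s t ss st Hs Ht; rewrite mulrA morita_diagM -!big_rcons.
apply: Hw; rewrite ?size_rcons ?ss ?st // => y; rewrite mem_rcons inE.
  by case/predU1P=> [->|/Hs //]; exists (tens m' n).
by case/predU1P=> [->|/Ht //]; exists (tens n' m).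
Qed.

Hypothesis nilMN : nilpotent_ideal (trace_MN K).
Hypothesis nilNM : nilpotent_ideal (trace_NM K).

Lemma off_ann_all : exists j, forall w, off_ann j w.
Proof.
have [k Pk] := nilpotent_ideal_prod nilMN.
have [l Pl] := nilpotent_ideal_prod nilNM.
(* Lists of length k + l are long enough for both ideals. *)
exists (k + l).*2 => w; apply: off_ann_prods => s t ss st Hs Ht.
rewrite Pk ?Pl ?ss ?st ?leq_addr ?leq_addl //.
by rewrite -[morita_diag 0 0]/(0 : R) mul0r.
Qed.

Lemma morita_diagDoff (x : R) :
  x = morita_diag (m11 x) (m22 x) + morita_off (m12 x) (m21 x).
Proof. by case: x => a m n b; congr MoritaMx; rewrite /= ?addr0 ?add0r. Qed.

Lemma trace_diag_nilpotent (z : R) :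
  trace_MN K (m11 z) -> trace_NM K (m22 z) -> nilpotent_elt z.
Proof.
move=> z11 z22; have [j annj] := off_ann_all; exists j.
(* Let [z ^+ j] act on any [w] of level j: each factor [z] lowers the level by at least one. *)
rewrite -[z ^+ j]mulr1; move: (1 : R) (annj 1).
elim: j {annj} => [|j IHj] w Hw.
  by rewrite mul1r.
rewrite exprSr -mulrA; apply: IHj.
rewrite [z in z * w]morita_diagDoff mulrDl -[X in _ + X]opprK; apply: off_annB.
  exact/off_ann_trace/off_annS.
rewrite -sub0r; apply: off_annB; [exact: off_ann0 | exact: Hw].
Qed.

(** * Passing between the matrix ring and its corners *)

Lemma morita_nilpotent (x : R) :
  nilpotent_elt (m11 x) -> nilpotent_elt (m22 x) -> nilpotent_elt x.
Proof.
move=> [k nil_k] [l nil_l].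
(* The power k + l kills both diagonal entries modulo the trace ideals. *)
have [||j nil_j] := @trace_diag_nilpotent (x ^+ (k + l)).
- by have := m11_XnB x (k + l); rewrite [m11 x ^+ _]exprD nil_k mul0r subr0.
- by have := m22_XnB x (k + l); rewrite [m22 x ^+ _]exprD nil_l mulr0 subr0.
by exists ((k + l) * j)%N; rewrite exprM.
Qed.

Lemma nil_clean_m11 (x : R) : nil_clean x -> nil_clean (m11 x).
Proof.
have idJ := trace_MN_ideal K.
case=> e [q [ee [n qn] ->]]; rewrite -[m11 _]/(m11 e + m11 q).
apply: (nil_clean_modulo_nil (n := n) idJ) => [y||].
- exact: nilpotent_ideal_nil.
- by have := two_sided_idealN idJ (m11_XnB e 2); rewrite opprB !expr2 ee.
- by have := two_sided_idealN idJ (m11_XnB q n); rewrite opprB qn subr0.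
Qed.

Lemma nil_clean_m22 (x : R) : nil_clean x -> nil_clean (m22 x).
Proof.
have idJ := trace_NM_ideal K.
case=> e [q [ee [n qn] ->]]; rewrite -[m22 _]/(m22 e + m22 q).
apply: (nil_clean_modulo_nil (n := n) idJ) => [y||].
- exact: nilpotent_ideal_nil.
- by have := two_sided_idealN idJ (m22_XnB e 2); rewrite opprB !expr2 ee.
- by have := two_sided_idealN idJ (m22_XnB q n); rewrite opprB qn subr0.
Qed.

End MoritaRingTheory.

Theorem theorem2p34 (A B : nzRingType) (M : bimodType A B) (N : bimodType B A)
    (K : morita_context M N) :
  nilpotent_ideal (trace_MN K) ->
  nilpotent_ideal (trace_NM K) ->
  (GNC_ring (morita_ring K) <-> nil_clean_ring A /\ nil_clean_ring B).
Proof.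
move=> nilMN nilNM; split=> [gncR|[ncA ncB] x _].
  split=> [a|b].
    rewrite -[a]/(m11 (morita_diag K a 0)); apply/(nil_clean_m11 nilMN)/gncR.
    (* The (2,2) entry of diag(a, 0) * y is 0, but that of the identity is 1. *)
    case=> y [/(congr1 (fun z => m22 z)) /= /eqP].
    by rewrite tens0l raddf0 mul0r addr0 eq_sym oner_eq0.
  rewrite -[b]/(m22 (morita_diag K 0 b)); apply/(nil_clean_m22 nilNM)/gncR.
  case=> y [/(congr1 (fun z => m11 z)) /= /eqP].
  by rewrite tens0l raddf0 mul0r addr0 eq_sym oner_eq0.
have [e [q [ee nil_q xe]]] := ncA (m11 x).
have [f [p [ff nil_p xf]]] := ncB (m22 x).
exists (morita_diag K e f), (MoritaMx q (m12 x) (m21 x) p); split.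
- by rewrite /idempotent_elt morita_diagM ee ff.
- exact: morita_nilpotent.
- by case: x xe xf => a m n b /= -> ->; congr MoritaMx; rewrite /= add0r.
Qed.
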